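(* Let $k\in\mathbb{Z}$ and $n\in\mathbb{Z}^+$. Then $\chi_{n,k}(R_3)=3$ if $\gcd(7,n)\mid k$ and $\chi_{n,k}(R_3)=4$ otherwise; $\chi_{n,k}(R_4)=2$ if $\gcd(5,n)\mid k$ and $\chi_{n,k}(R_4)=3$ otherwise; $\chi_{n,k}(R_6)=2$ if $\gcd(8,n)\mid 2k$ and $\chi_{n,k}(R_6)=3$ otherwise.
   Context: $R_3$, $R_4$, $R_6$ denote the infinite graphs formed by the vertices and edges of the regular tilings of the plane by equilateral triangles (the $6$-regular triangular lattice), squares (the $4$-regular square grid $\mathbb{Z}^2$), and regular hexagons (the $3$-regular hexagonal lattice), respectively. For a graph $G=(V,E)$, a labeling $\ell:V\to\mathbb{Z}$ is proper if adjacent vertices get distinct labels, its order is the size of its image, and it is a closed coloring with remainder $k\bmod n$ if $\sum_{w\in N[v]}\ell(w)\equiv k\pmod n$ for every $v$, where $N[v]$ is the closed neighborhood of $v$. $\chi_{n,k}(G)$ is the minimum order of a proper closed coloring with remainder $k\bmod n$. *)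

(* Defs.v *)
From HB Require Import structures.
From mathcomp Require Import all_boot all_order all_algebra.
From mathcomp Require Import all_classical.
From mathcomp Require Import zify.

Set Implicit Arguments.
Unset Strict Implicit.
Unset Printing Implicit Defensive.

Import Order.TTheory GRing.Theory Num.Theory.

Local Open Scope classical_set_scope.
Local Open Scope ring_scope.

(* Possibly infinite simple graphs; local finiteness makes the sums over closed
   neighborhoods meaningful. *)
Record graph := Graph {
  vertex :> choiceType;
  adj : rel vertex;
  adj_sym : symmetric adj;
  adj_irr : irreflexive adj;
  adj_fin : forall v, finite_set [set w | adj v w] }.

Section ClosedColoring.
Variable G : graph.
Implicit Types (l : G -> int) (v : G) (n k : int) (m : nat).

Definition closed_nbhd v : set G := [set w | w = v \/ adj v w].

Lemma closed_nbhd_fin v : finite_set (closed_nbhd v).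
Proof.
have -> : closed_nbhd v = [set v] `|` [set w | adj v w] by [].
by rewrite finite_setU; split; [exact: finite_set1 | exact: adj_fin].
Qed.

Definition proper_labeling l := forall u v, adj u v -> l u <> l v.

Definition has_order l m := (range l #= `I_m)%card.

Definition closed_coloring n k l :=
  forall v, (\sum_(w \in closed_nbhd v) l w = k %[mod n])%Z.

Definition closed_coloring_order n k m :=
  exists l, [/\ proper_labeling l, closed_coloring n k l & has_order l m].

Definition min_closed_coloring_order n k m :=
  closed_coloring_order n k m /\
  forall m', closed_coloring_order n k m' -> (m <= m')%N.

(* The default 0 is returned only when no proper closed coloring has finite
   order; it is never the order of a labeling of a nonempty graph. *)
Definition closed_chi n k : nat :=
  xget 0%N [set m | min_closed_coloring_order n k m].

End ClosedColoring.

Arguments closed_chi : clear implicits.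

(* The tilings have edges of length 1, and two vertices of a tiling are joined
   by an edge iff they are at Euclidean distance 1.  The pair (a, b) stands for
   the point a + b i of the square lattice, or a + b e^(i pi / 3) of the
   triangular lattice; the squared distances to the origin are respectively
   a^2 + b^2 and a^2 + a b + b^2. *)
Definition sq_norm4 (p : int * int) : int := p.1 ^+ 2 + p.2 ^+ 2.
Definition sq_norm3 (p : int * int) : int := p.1 ^+ 2 + p.1 * p.2 + p.2 ^+ 2.

Definition adj4 : rel (int * int) := fun u v => sq_norm4 (v - u) == 1.
Definition adj3 : rel (int * int) := fun u v => sq_norm3 (v - u) == 1.

Definition steps4 : seq (int * int) := [:: (1, 0); (-1, 0); (0, 1); (0, -1)].
Definition steps3 : seq (int * int) :=
  [:: (1, 0); (-1, 0); (0, 1); (0, -1); (1, -1); (-1, 1)].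

Lemma sq_norm4E p : (sq_norm4 p == 1) = (p \in steps4).
Proof.
case: p => a b; rewrite /sq_norm4 !inE !xpair_eqE /= !expr2.
apply/idP/idP; last by lia.
by move=> /eqP h; have : -1 <= a <= 1 /\ -1 <= b <= 1; [split; nia | nia].
Qed.

Lemma sq_norm3E p : (sq_norm3 p == 1) = (p \in steps3).
Proof.
case: p => a b; rewrite /sq_norm3 !inE !xpair_eqE /= !expr2.
apply/idP/idP; last by lia.
by move=> /eqP h; have : -1 <= a <= 1 /\ -1 <= b <= 1; [split; nia | nia].
Qed.

Lemma adj4E u v : adj4 u v = (v - u \in steps4).
Proof. exact: sq_norm4E. Qed.

Lemma adj3E u v : adj3 u v = (v - u \in steps3).
Proof. exact: sq_norm3E. Qed.

Lemma adj4_sym : symmetric adj4.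
Proof. by move=> [a b] [c d]; rewrite /adj4 /sq_norm4 /= -(opprB c) -(opprB d) !sqrrN. Qed.

Lemma adj3_sym : symmetric adj3.
Proof.
by move=> [a b] [c d]; rewrite /adj3 /sq_norm3 /= -(opprB c) -(opprB d) !sqrrN mulrNN.
Qed.

Lemma adj4_irr : irreflexive adj4.
Proof. by move=> u; rewrite adj4E subrr. Qed.

Lemma adj3_irr : irreflexive adj3.
Proof. by move=> u; rewrite adj3E subrr. Qed.

Lemma steps_fin (s : seq (int * int)) (u : int * int) :
  finite_set [set v | v - u \in s].
Proof.
apply: (@sub_finite_set _ _ [set` [seq u + t | t <- s]]); last exact: finite_seq.
by move=> v /= vs; apply/mapP; exists (v - u) => //; rewrite addrC subrK.
Qed.

Lemma adj4_fin u : finite_set [set v | adj4 u v].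
Proof.
by apply: sub_finite_set (steps_fin steps4 u) => v; rewrite /= adj4E.
Qed.

Lemma adj3_fin u : finite_set [set v | adj3 u v].
Proof.
by apply: sub_finite_set (steps_fin steps3 u) => v; rewrite /= adj3E.
Qed.

Definition R4 : graph := Graph adj4_sym adj4_irr adj4_fin.
Definition R3 : graph := Graph adj3_sym adj3_irr adj3_fin.

(* The hexagonal tiling is the triangular one with the centers of the hexagons
   removed; the centers form the sublattice of index 3 given by a = b mod 3. *)
Definition hex_vertex : choiceType :=
  {p : int * int | ~~ (3 %| (p.1 - p.2)%R)%Z}.

Definition adj6 : rel hex_vertex := fun u v => adj3 (val u) (val v).

Lemma adj6_sym : symmetric adj6.
Proof. by move=> u v; exact: adj3_sym. Qed.

Lemma adj6_irr : irreflexive adj6.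
Proof. by move=> u; exact: adj3_irr. Qed.

Lemma adj6_fin u : finite_set [set v | adj6 u v].
Proof.
apply: (finite_preimage (f := val) (in2W val_inj) (adj3_fin (val u))).
Qed.

Definition R6 : graph := Graph adj6_sym adj6_irr adj6_fin.

(* Main.v *)
(** A labeling using two labels x, y on a d-regular bipartite graph must put x on
one side and y on the other, so it is closed iff x + d y = y + d x = k mod n.  On
the triangular lattice a labeling with three labels x, y, z is determined by its
values on one triangle, and adding the conditions at the corners of that triangle
gives 7 (x + y + z) = 3 k mod n.  These congruences yield the divisibility
conditions, and conversely one solves them with labels x, x + n, x + 2 n (or, in
the hexagonal case, possibly labels differing by an odd multiple of n / 2).

All three lattices have a perfect code, that is, a set of vertices meeting every
closed neighborhood exactly once.  Putting k on the code and multiples of n given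
by a proper coloring elsewhere costs one more label and is closed for every k;
it is proper when n does not divide k. *)

Require Import Defs.
From mathcomp Require Import all_boot all_order all_algebra.
From mathcomp Require Import all_classical.
From mathcomp Require Import zify ring.

Set Implicit Arguments.
Unset Strict Implicit.
Unset Printing Implicit Defensive.

Import Order.TTheory GRing.Theory Num.Theory.

Local Open Scope classical_set_scope.
Local Open Scope ring_scope.

(** * Orders of labelings and the minimum order *)

Section Order.
Variable G : graph.
Implicit Types (l : G -> int) (n k : int) (m : nat).

Lemma closed_nbhd_sum (f : G -> int) (v : G) (s : seq G) :
  uniq s -> (forall w, adj v w = (w \in s)) ->
  \sum_(w \in closed_nbhd v) f w = f v + \sum_(w <- s) f w.
Proof.
move=> us vs; have -> : closed_nbhd v = [set` v :: s].
  apply/seteqP; split=> w /=; rewrite inE.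
    by case=> [->|]; rewrite ?eqxx // vs => ->; rewrite orbT.
  by case/orP=> [/eqP->|ws]; [left | right; rewrite vs].
rewrite -fsbig_seq ?big_cons //= us andbT.
by have := @adj_irr G v; rewrite vs /= => ->.
Qed.

Lemma has_order_ge l m (s : seq int) :
  has_order l m -> uniq s -> (forall x, x \in s -> range l x) -> (size s <= m)%N.
Proof.
move=> lm us sl; have fl : finite_set (range l) by apply/finite_setP; exists m.
rewrite -(card_fset_set lm); apply: uniq_leq_size us _ => x /sl lx.
by rewrite in_fset_set // inE.
Qed.

Lemma has_order_full l m (s : seq int) :
  has_order l m -> uniq s -> (forall x, x \in s -> range l x) -> size s = m ->
  forall v, l v \in s.
Proof.
move=> lm us sl sm v; apply: contraT => nv.
suff : (size (l v :: s) <= m)%N by rewrite /= sm ltnn.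
apply: has_order_ge lm _ _; first by rewrite /= nv.
by move=> x; rewrite inE => /orP[/eqP->|/sl //]; exists v.
Qed.

Lemma has_order_le l (s : seq int) :
  (forall v, l v \in s) -> exists2 m, has_order l m & (m <= size s)%N.
Proof.
move=> ls; have fl : finite_set (range l).
  by apply: sub_finite_set (finite_seq s) => _ [v _ <-]; exact: ls.
have [m lm] := (finite_setP _).1 fl; exists m => //.
rewrite -(card_fset_set lm); apply: uniq_leq_size => [|x]; first exact: finmap.fset_uniq.
by rewrite in_fset_set // inE => -[v _ <-].
Qed.

(** A minimum order is unique, so the choice made by [xget] is forced. *)
Lemma min_order_chi n k m :
  min_closed_coloring_order G n k m -> closed_chi G n k = m.
Proof.
move=> mP; apply: xget_subset1 => // a b [ha amin] [hb bmin].
by apply/eqP; rewrite eqn_leq amin ?bmin.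
Qed.

(** The list [s] only has to contain the labels: the lower bound forces the order of [l] to be
    exactly [m], so no label needs to be shown attained. *)
Lemma closed_chi_eq n k l m (s : seq int) :
  proper_labeling l -> closed_coloring n k l -> (forall v, l v \in s) ->
  (size s <= m)%N -> (forall m', closed_coloring_order G n k m' -> (m <= m')%N) ->
  closed_chi G n k = m.
Proof.
move=> pl cl ls sm mmin; apply: min_order_chi; split=> //.
have [m' lm' m's] := has_order_le ls.
have mm' : (m <= m')%N by apply: mmin; exists l.
suff -> : m = m' by exists l.
by apply/eqP; rewrite eqn_leq mm' (leq_trans m's).
Qed.

End Order.

(** * Labelings built from a proper coloring or a perfect code *)

Section Constructions.
Variable G : graph.
Implicit Types (l c : G -> int) (n k : int).

Definition regular_graph (d : nat) := forall v : G,
  exists s : seq G, [/\ uniq s, size s = d & (forall w, adj v w = (w \in s))].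

Definition perfect_code (C : pred G) := forall v : G,
  exists s : seq G, [/\ uniq s, (forall w, adj v w = (w \in s)) & (C v + count C s = 1)%N].

Lemma sumr_const_seq (T : Type) (s : seq T) (x : int) :
  \sum_(w <- s) x = x *+ size s.
Proof. by rewrite big_const_seq count_predT iter_addr_0. Qed.

Lemma sum_affine (T : Type) (s : seq T) (x n : int) (c : T -> int) :
  \sum_(w <- s) (x + n * c w) = x *+ size s + n * \sum_(w <- s) c w.
Proof.
by rewrite big_split /= -mulr_sumr sumr_const_seq.
Qed.

(** Modulo [n] every label is [x], so each closed neighborhood sums to [(d + 1) x], whatever [c]
    is. *)
Lemma affine_closed_coloring d n k x c :
  regular_graph d -> (n %| x *+ d.+1 - k)%Z ->
  closed_coloring n k (fun w => x + n * c w).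
Proof.
move=> rd /dvdzP[q xk] v; have [s [us sd vs]] := rd v.
apply/eqP; rewrite eqz_mod_dvd (closed_nbhd_sum _ us vs) sum_affine sd.
apply/dvdzP; exists (q + c v + \sum_(w <- s) c w).
have -> : x *+ d = q * n + k - x by move: xk; rewrite mulrS; lia.
ring.
Qed.

Lemma affine_proper_labeling n x c :
  n != 0 -> proper_labeling c -> proper_labeling (fun w => x + n * c w).
Proof. by move=> n0 pc u v /pc cuv /addrI /(mulfI n0). Qed.

Lemma perfect_code_indep C (u v : G) : perfect_code C -> adj u v -> C u -> ~~ C v.
Proof.
move=> pC uv Cu; have [s [us ust]] := pC u; rewrite Cu add1n => -[/eqP].
rewrite -leqn0 leqNgt -has_count => /hasPn; apply.
by rewrite -ust.
Qed.

(** The single code vertex of a closed neighborhood contributes [k], all others multiples of [n]. *)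
Lemma code_labeling_closed n k c C :
  perfect_code C -> closed_coloring n k (fun w => if C w then k else n * c w).
Proof.
move=> pC v; have [s [us vs Cs]] := pC v; rewrite (closed_nbhd_sum _ us vs).
(* Erasing [c] on the code splits the label into [k] times the indicator of the code plus
   [n * b]. *)
pose b w : int := if C w then 0 else c w.
have lE w : (if C w then k else n * c w) = k * (C w)%:Z + n * b w.
  by rewrite /b; case: (C w); rewrite /= ?mulr1 ?mulr0 ?addr0 ?add0r.
under eq_bigr do rewrite lE.
apply/eqP; rewrite eqz_mod_dvd; apply/dvdzP; exists (b v + \sum_(w <- s) b w).
have CE : \sum_(w <- s) (C w)%:Z = 1 - (C v)%:Z.
  suff -> : \sum_(w <- s) (C w)%:Z = (count C s)%:Z by lia.
  by elim: (s) => [|w t IH] /=; rewrite ?big_nil // big_cons IH PoszD.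
rewrite lE big_split /= -!mulr_sumr CE; ring.
Qed.

Lemma code_labeling_proper n k c C : n != 0 -> ~~ (n %| k)%Z ->
  perfect_code C -> proper_labeling c ->
  proper_labeling (fun w => if C w then k else n * c w).
Proof.
move=> n0 nk pC pc u v uv.
case: ifPn => Cu; case: ifPn => Cv.
- by have := perfect_code_indep pC uv Cu; rewrite Cv.
- by move=> kE; move: nk; rewrite kE dvdz_mulr.
- by move=> kE; move: nk; rewrite -kE dvdz_mulr.
- by move=> /(mulfI n0); exact: pc.
Qed.

End Constructions.

(** * Regular bipartite graphs with a perfect code *)

Section Bipartite.
Variables (G : graph) (d : nat) (c : G -> bool) (C : pred G) (u0 v0 : G).
Hypotheses (rd : regular_graph G d) (pc : forall u v : G, adj u v -> c u = ~~ c v).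
Hypotheses (pC : perfect_code C) (uv0 : adj u0 v0).
Variables n k : int.
Hypothesis n0 : n != 0.

Lemma bipartite_order_ge2 m : closed_coloring_order G n k m -> (2 <= m)%N.
Proof.
move=> [l [pl _ lm]]; apply: (@has_order_ge _ l m [:: l u0; l v0]) => //.
  by rewrite /= inE andbT; apply/eqP/pl.
by move=> x; rewrite !inE => /orP[] /eqP->; [exists u0 | exists v0].
Qed.

Lemma two_label_sum (l : G -> int) (u : G) x y :
  l u = x -> (forall w, adj u w -> l w = y) ->
  \sum_(w \in closed_nbhd u) l w = x + y *+ d.
Proof.
move=> <- ly; have [s [us <- vs]] := rd u; rewrite (closed_nbhd_sum _ us vs).
congr (_ + _); rewrite -sumr_const_seq; apply: eq_big_seq => w ws.
by apply: ly; rewrite vs.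
Qed.

Lemma bipartite_order2 : closed_coloring_order G n k 2 <->
  exists x y, [/\ x != y, (n %| x + y *+ d - k)%Z & (n %| y + x *+ d - k)%Z].
Proof.
split=> [[l [pl cl lm]]|[x [y [xy h1 h2]]]].
  (* The labels of [u0] and [v0] are the only two, so all neighbors of either vertex carry the label
     of the other; the two congruences are the conditions at [u0] and [v0]. *)
  have luv := pl _ _ uv0.
  have lE : forall w, l w \in [:: l u0; l v0].
    apply: (@has_order_full _ l 2 [:: l u0; l v0]) => //; first by rewrite /= inE andbT; apply/eqP.
    by move=> x; rewrite !inE => /orP[] /eqP->; [exists u0 | exists v0].
  exists (l u0), (l v0); split; first exact/eqP.
    rewrite -eqz_mod_dvd -(two_label_sum erefl); first exact/eqP/cl.
    move=> w uw; have := lE w; rewrite !inE => /orP[] /eqP // E.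
    by case: (pl _ _ uw).
  rewrite -eqz_mod_dvd -(two_label_sum erefl); first exact/eqP/cl.
  move=> w uw; have := lE w; rewrite !inE => /orP[] /eqP // E.
  by case: (pl _ _ uw).
pose l w := if c w then x else y.
have pl : proper_labeling l.
  move=> u v uv; rewrite /l (pc uv).
  by case: (c v) => /= E; move: xy; rewrite E eqxx.
have cl : closed_coloring n k l.
  move=> v; apply/eqP; rewrite eqz_mod_dvd; case cv: (c v).
    rewrite (@two_label_sum l v x y) // /l ?cv // => w /pc; rewrite cv.
    by case: (c w).
  rewrite (@two_label_sum l v y x) // /l ?cv // => w /pc; rewrite cv.
  by case: (c w).
have [|m lm m2] := @has_order_le _ l [:: x; y].
  by move=> v; rewrite !inE /l; case: ifP; rewrite eqxx ?orbT.
suff <- : m = 2%N by exists l.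
by apply/eqP; rewrite eqn_leq m2 bipartite_order_ge2 //; exists l.
Qed.

Lemma bipartite_chi2 : closed_coloring_order G n k 2 -> closed_chi G n k = 2%N.
Proof. by move=> h; apply: min_order_chi; split=> //; exact: bipartite_order_ge2. Qed.

Lemma bipartite_chi3 : ~ closed_coloring_order G n k 2 -> closed_chi G n k = 3%N.
Proof.
(* If [n] divided [k], the labels 0 and [n] would already give order 2. Hence the code labeling is
   proper. *)
move=> h; have nk : ~~ (n %| k)%Z.
  apply/negP => /dvdzP[q kE]; apply: h; apply/bipartite_order2.
  exists 0, n; split; first by rewrite eq_sym.
    by apply/dvdzP; exists (d%:Z - q); rewrite kE -mulr_natr; ring.
  by apply/dvdzP; exists (1 - q); rewrite mul0rn kE; ring.
have pb : proper_labeling (fun w => (c w)%:Z).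
  by move=> u v /pc ->; case: (c v).
apply: (@closed_chi_eq _ _ _ _ _ [:: k; 0; n] (code_labeling_proper n0 nk pC pb)).
- exact: code_labeling_closed.
- move=> v; case: ifP => _; rewrite !inE ?eqxx //.
  by case: (c v); rewrite ?mulr0 ?mulr1 eqxx ?orbT.
- by [].
- move=> m hm; rewrite ltn_neqAle bipartite_order_ge2 // andbT.
  by apply/eqP => E; apply: h; rewrite E.
Qed.

End Bipartite.

Lemma linear_congruence (a n k : int) :
  (gcdz a n %| k)%Z -> exists x, (n %| a * x - k)%Z.
Proof.
move=> /dvdzP[q ->]; have [u [v <-]] := Bezoutz a n.
by exists (q * u); apply/dvdzP; exists (- (q * v)); ring.
Qed.

(** * Neighborhoods, perfect codes and colorings of the three lattices *)

Lemma nbhd4 v w : adj4 v w = (w \in [seq v + t | t <- steps4]).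
Proof.
rewrite adj4E; case: v w => a b [e f]; rewrite /= !inE !xpair_eqE /=; lia.
Qed.

Lemma nbhd3 v w : adj3 v w = (w \in [seq v + t | t <- steps3]).
Proof.
rewrite adj3E; case: v w => a b [e f]; rewrite /= !inE !xpair_eqE /=; lia.
Qed.

Lemma uniq_nbhd (s : seq (int * int)) (v : int * int) :
  uniq s -> uniq [seq v + t | t <- s].
Proof. by move=> us; rewrite map_inj_uniq //; exact: addrI. Qed.

Lemma R4_regular : regular_graph R4 4.
Proof.
move=> v; exists [seq v + t | t <- steps4]; split=> //; [exact: uniq_nbhd | exact: nbhd4].
Qed.

Lemma R3_regular : regular_graph R3 6.
Proof.
move=> v; exists [seq v + t | t <- steps3]; split=> //; [exact: uniq_nbhd | exact: nbhd3].
Qed.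

(* The values of a + 2 b on the steps and 0 are the residues mod 5. *)
Lemma R4_perfect_code :
  perfect_code (G := R4) (fun v : int * int => (5 %| v.1 + 2 * v.2)%Z).
Proof.
move=> v; exists [seq v + t | t <- steps4]; split; [exact: uniq_nbhd | exact: nbhd4 |].
case: v => a b /=; lia.
Qed.

(* The values of a + 3 b on the steps and 0 are the residues mod 7. *)
Lemma R3_perfect_code :
  perfect_code (G := R3) (fun v : int * int => (7 %| v.1 + 3 * v.2)%Z).
Proof.
move=> v; exists [seq v + t | t <- steps3]; split; [exact: uniq_nbhd | exact: nbhd3 |].
case: v => a b /=; lia.
Qed.

Definition nbhd6 (v : R6) : seq R6 :=
  pmap insub [seq val v + t | t <- steps3].

Lemma nbhd6_uniq v : uniq (nbhd6 v).
Proof. by apply/pmap_sub_uniq/uniq_nbhd. Qed.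

Lemma mem_nbhd6 v w : @adj R6 v w = (w \in nbhd6 v).
Proof. by rewrite mem_pmap_sub; exact: nbhd3. Qed.

Lemma count_nbhd6 (C : pred (int * int)) (v : R6) :
  count (C \o val) (nbhd6 v) =
  count (predI C (fun p => ~~ (3 %| p.1 - p.2)%Z)) [seq val v + t | t <- steps3].
Proof.
rewrite -count_map (pmap_filter (insubK _)) count_filter; apply: eq_count => p /=.
by rewrite isSome_insub.
Qed.

Lemma R6_regular : regular_graph R6 3.
Proof.
move=> v; exists (nbhd6 v); split; [exact: nbhd6_uniq| |exact: mem_nbhd6].
(* Three steps change [a - b] by 1 mod 3 and three by -1, so exactly three of the six triangular
   neighbors are hexagon centers. *)
rewrite /nbhd6 size_pmap_sub; case: v => -[a b] /=; lia.
Qed.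

(* The three steps from class a - b = 1 to class a - b = 2 (mod 3) change b by
   0, -1, 1, hence the shift by 2 mod 4 between the two classes; hexagon centers
   are excluded. *)
Definition code6 (v : int * int) : bool :=
  if (3 %| v.1 - v.2 - 1)%Z then (4 %| v.2)%Z
  else (3 %| v.1 - v.2 - 2)%Z && (4 %| v.2 - 2)%Z.

Lemma code6_0 v : (3 %| v.1 - v.2)%Z -> code6 v = false.
Proof. case: v => a b /=; rewrite /code6 /=; case: ifP; lia. Qed.

Lemma code6_1 v : (3 %| v.1 - v.2 - 1)%Z -> code6 v = (4 %| v.2)%Z.
Proof. by rewrite /code6 => ->. Qed.

Lemma code6_2 v : (3 %| v.1 - v.2 - 2)%Z -> code6 v = (4 %| v.2 - 2)%Z.
Proof. case: v => a b /= h; rewrite /code6 /= h; case: ifP; lia. Qed.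

(** In class 1 the vertex is in the code if [b = 0] mod 4, and its three neighbors of class 2 are if
    [b = 2, 3, 1] respectively; in class 2 the vertex needs [b = 2] and its neighbors [b = 0, 3, 1].
    Exactly one case occurs. *)
Lemma code6_count v : ~~ (3 %| v.1 - v.2)%Z ->
  (code6 v + count code6 [seq (v + t)%R | t <- steps3] = 1)%N.
Proof.
case: v => a b /= h; have [h1|h2] : (3 %| a - b - 1)%Z \/ (3 %| a - b - 2)%Z by lia.
  rewrite (code6_1 (v := (a, b))) /=; last lia.
  rewrite (code6_2 (v := (a + 1, b + 0))) /=; last lia.
  rewrite (code6_0 (v := (a - 1, b + 0))) /=; last lia.
  rewrite (code6_0 (v := (a + 0, b + 1))) /=; last lia.
  rewrite (code6_2 (v := (a + 0, b - 1))) /=; last lia.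
  rewrite (code6_0 (v := (a + 1, b - 1))) /=; last lia.
  rewrite (code6_2 (v := (a - 1, b + 1))) /=; last lia.
  clear; lia.
rewrite (code6_2 (v := (a, b))) /=; last lia.
rewrite (code6_0 (v := (a + 1, b + 0))) /=; last lia.
rewrite (code6_1 (v := (a - 1, b + 0))) /=; last lia.
rewrite (code6_1 (v := (a + 0, b + 1))) /=; last lia.
rewrite (code6_0 (v := (a + 0, b - 1))) /=; last lia.
rewrite (code6_1 (v := (a + 1, b - 1))) /=; last lia.
rewrite (code6_0 (v := (a - 1, b + 1))) /=; last lia.
clear; lia.
Qed.

Lemma R6_perfect_code : perfect_code (G := R6) (code6 \o val).
Proof.
move=> v; exists (nbhd6 v); split; [exact: nbhd6_uniq|exact: mem_nbhd6|].
rewrite count_nbhd6; apply: etrans (code6_count (valP v)).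
congr (_ + _)%N; apply: eq_count => p.
(* [code6] is false at hexagon centers, so discarding them does not change the count. *)
by rewrite /= andb_idr // => Cp; apply/negP => /code6_0; rewrite Cp.
Qed.

Definition color4 (v : R4) : bool := (2 %| v.1 + v.2)%Z.

Lemma color4_proper (u v : R4) : adj u v -> color4 u = ~~ color4 v.
Proof.
rewrite [adj u v]nbhd4 /color4; case: u v => a b [e f] /=.
rewrite !inE !xpair_eqE /=; lia.
Qed.

Definition color6 (v : R6) : bool := ((val v).1 - (val v).2 == 1 %[mod 3])%Z.

Lemma color6_proper (u v : R6) : adj u v -> color6 u = ~~ color6 v.
Proof.
rewrite [adj u v]nbhd3 /color6; case: u v => -[a b] /= hu [[e f] /= hv].
rewrite !inE !xpair_eqE /=; lia.
Qed.

Definition color3 (v : R3) : int := ((v.1 - v.2) %% 3)%Z.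

Lemma color3_proper : proper_labeling color3.
Proof.
move=> u v; rewrite [adj u v]nbhd3 /color3; case: u v => a b [e f] /=.
rewrite !inE !xpair_eqE /=; lia.
Qed.

Lemma color3_mem v : color3 v \in [:: 0; 1; 2].
Proof. by rewrite /color3 !inE; lia. Qed.

(** * Lower bounds on the triangular lattice *)

Section R3.
Variables n k : int.

Let o : R3 := (0, 0).
Let p : R3 := (1, 0).
Let q : R3 := (0, 1).

Lemma R3_triangle l : proper_labeling l -> uniq [:: l o; l p; l q].
Proof.
move=> pl; rewrite /= !inE negb_or andbT -andbA.
by apply/and3P; split; apply/eqP/pl.
Qed.

Lemma R3_order_ge3 m : closed_coloring_order R3 n k m -> (3 <= m)%N.
Proof.
move=> [l [pl _ lm]]; apply: has_order_ge lm (R3_triangle pl) _ => x.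
by rewrite !inE => /or3P[] /eqP->; [exists o | exists p | exists q].
Qed.

Lemma R3_order3 :
  closed_coloring_order R3 n k 3 -> exists x, (n %| 7 * x - 3 * k)%Z.
Proof.
move=> [l [pl cl lm]]; have ul := R3_triangle pl.
have lE v : l v \in [:: l o; l p; l q].
  apply: (@has_order_full _ l 3 [:: l o; l p; l q]) => // x.
  by rewrite !inE => /or3P[] /eqP->; [exists o | exists p | exists q].
(* Two triangles sharing the edge [b c]: both opposite corners must take the third label. *)
have rhombus (a b c d : R3) : adj a b -> adj a c -> adj b c ->
    adj d b -> adj d c -> l d = l a.
  move=> /pl ab /pl ac /pl bc /pl db /pl dc; move: (lE a) (lE b) (lE c) (lE d).
  by rewrite !inE; lia.
have sumE (v : int * int) :
    (n %| (l v + (l (v + (1, 0)%R) + (l (v + (-1, 0)%R) + (l (v + (0, 1)%R)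
           + (l (v + (0, -1)%R) + (l (v + (1, -1)%R) + l (v + (-1, 1)%R)%R)))))
           - k)%R)%Z.
  rewrite -eqz_mod_dvd; apply/eqP; rewrite -(cl v).
  rewrite (closed_nbhd_sum l (uniq_nbhd v (isT : uniq steps3)) (nbhd3 v)).
  by rewrite !big_cons big_nil addr0.
(* Reflecting across edges propagates the labels of the triangle [o p q] to all other neighbors of
   its corners. *)
have e1 : l (1, 1) = l o by apply: (rhombus o p q).
have e2 : l (-1, 1) = l p by apply: (rhombus p o q).
have e3 : l (1, -1) = l q by apply: (rhombus q o p).
have e4 : l (-1, 0) = l q by apply: (rhombus q o (-1, 1)).
have e5 : l (0, -1) = l p by apply: (rhombus p o (1, -1)).
have e6 : l (2, 0) = l q by apply: (rhombus q p (1, 1)).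
have e7 : l (2, -1) = l o by apply: (rhombus o p (1, -1)).
have e8 : l (0, 2) = l p by apply: (rhombus p q (1, 1)).
have e9 : l (-1, 2) = l o by apply: (rhombus o q (-1, 1)).
have so : (n %| l o + (l p + (l (-1, 0) + (l q + (l (0, -1)
  + (l (1, -1) + l (-1, 1)))))) - k)%Z := sumE o.
have sp : (n %| l p + (l (2, 0) + (l o + (l (1, 1) + (l (1, -1)
  + (l (2, -1) + l q))))) - k)%Z := sumE p.
have sq : (n %| l q + (l (1, 1) + (l (-1, 1) + (l (0, 2) + (l o
  + (l p + l (-1, 2)))))) - k)%Z := sumE q.
(* Each corner sees its own label once and the other two labels three times each, so every label is
   counted 1 + 3 + 3 = 7 times in total. *)
exists (l o + l p + l q); have := rpredD (rpredD so sp) sq.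
rewrite e1 e2 e3 e4 e5 e6 e7 e8 e9.
by rewrite (_ : _ + _ = 7 * (l o + l p + l q) - 3 * k) //; ring.
Qed.
End R3.

(** * The values of the closed chromatic numbers *)

Lemma R3_chi (k n : int) : n != 0 ->
  closed_chi R3 n k = (if (gcdz 7 n %| k)%Z then 3 else 4)%N.
Proof.
move=> n0; case: ifPn => nk.
  have [x xk] := linear_congruence nk.
  apply: (@closed_chi_eq R3 n k (fun v => x + n * color3 v) 3
            [seq x + n * i | i <- [:: 0; 1; 2]]) => //.
  - exact: affine_proper_labeling color3_proper.
  - apply: affine_closed_coloring R3_regular _.
    by rewrite -mulr_natl.
  - by move=> v; exact: (map_f (fun i => x + n * i) (color3_mem v)).
  - exact: R3_order_ge3.
have ndk : ~~ (n %| k)%Z.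
  by apply: contra nk; apply: dvdz_trans; exact: dvdz_gcdr.
apply: (@closed_chi_eq R3 n k _ 4 (k :: [seq n * i | i <- [:: 0; 1; 2]])
          (code_labeling_proper n0 ndk R3_perfect_code color3_proper)).
- exact: code_labeling_closed R3_perfect_code.
- move=> v; rewrite in_cons; case: ifP => _; rewrite ?eqxx //.
  by rewrite (map_f (fun i => n * i) (color3_mem v)) orbT.
- by [].
move=> m hm; rewrite ltn_neqAle (R3_order_ge3 hm) andbT.
apply/eqP => mE; rewrite -mE in hm; have [x xk] := R3_order3 hm.
case/negP: nk; have g7 := dvdz_gcdl 7 n; have gx := dvdz_trans (dvdz_gcdr 7 n) xk.
(* The factor 3 is invertible modulo 7: since 7 - 2 * 3 = 1, [k] is a combination of 7 and
   [7 * x - 3 * k]. *)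
rewrite (_ : k = 7 * (k - 2 * x) + 2 * (7 * x - 3 * k)); last ring.
by apply: rpredD; [exact: dvdz_mulr | exact: dvdz_mull].
Qed.

Lemma R4_chi (k n : int) : n != 0 ->
  closed_chi R4 n k = (if (gcdz 5 n %| k)%Z then 2 else 3)%N.
Proof.
move=> n0; have uv0 : @adj R4 (0, 0) (1, 0) by [].
have E := bipartite_order2 R4_regular color4_proper uv0 n k.
case: ifPn => nk.
  apply: (bipartite_chi2 uv0); apply/E.
  have [x /dvdzP[t xk]] := linear_congruence nk.
  exists x, (x + n); split; first by rewrite -subr_eq0 opprD addNKr oppr_eq0.
    by apply/dvdzP; exists (t + 4); rewrite mulrDl -xk; ring.
  by apply/dvdzP; exists (t + 1); rewrite mulrDl -xk; ring.
apply: (bipartite_chi3 R4_regular color4_proper R4_perfect_code uv0 n0) => /E.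
case=> x [y [_ h1 h2]]; case/negP: nk.
have g5 := dvdz_gcdl 5 n; have gn := dvdz_gcdr 5 n.
(* The two congruences add up to [5 (x + y) = 2 k], and 5 - 2 * 2 = 1 recovers [k]. *)
rewrite (_ : k = 5 * (k - 2 * (x + y)) + 2 * ((x + y *+ 4 - k) + (y + x *+ 4 - k))); last ring.
apply: rpredD; first exact: dvdz_mulr.
by apply/dvdz_mull/rpredD; exact: dvdz_trans gn _.
Qed.

Lemma R6_chi (k n : int) : n != 0 ->
  closed_chi R6 n k = (if (gcdz 8 n %| (2 * k)%R)%Z then 2 else 3)%N.
Proof.
move=> n0; pose u0 : R6 := exist _ (1, 0) isT; pose v0 : R6 := exist _ (2, 0) isT.
have uv0 : adj u0 v0 by [].
have E := bipartite_order2 R6_regular color6_proper uv0 n k.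
case: ifPn => nk.
  apply: (bipartite_chi2 uv0); apply/E.
  have [x /dvdzP[t xk]] := linear_congruence nk.
  (* Here [8 x - 2 k = t n]. For even [t] this halves to [4 x = k] mod [n], and the labels [x] and
     [x + n] work. *)
  have [[s tE]|[s tE]] : (exists s, t = 2 * s) \/ (exists s, t = 2 * s + 1).
    have [tE|tE] : t = 2 * (t %/ 2)%Z \/ t = 2 * (t %/ 2)%Z + 1 by lia.
    - by left; exists (t %/ 2)%Z.
    - by right; exists (t %/ 2)%Z.
  - exists x, (x + n); split; first by rewrite -subr_eq0 opprD addNKr oppr_eq0.
      by apply/dvdzP; exists (s + 3); subst t; lia.
    by apply/dvdzP; exists (s + 1); subst t; lia.
  (* For odd [t] the modulus is even and [4 x - k = h t] with [h = n / 2]. The second label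
     [y = x - h t] makes [y + 3 x = k] exact and [x + 3 y - k = - t n]; it differs from [x] because
     [t] is odd and [h] nonzero. *)
  have [h nE] : exists h, n = 2 * h by exists (4 * x - k - s * n); subst t; lia.
  have kE : 4 * x - k = h * t by subst n; lia.
  exists x, (x - h * t); split.
  - rewrite -subr_eq0 opprB addrCA subrr addr0 mulf_neq0 //; last lia.
    by apply: contraNneq n0 => h0; rewrite nE h0 mulr0.
  - by apply/dvdzP; exists (- t); subst n; lia.
  - by apply/dvdzP; exists 0; lia.
apply: (bipartite_chi3 R6_regular color6_proper R6_perfect_code uv0 n0) => /E.
case=> x [y [_ h1 h2]]; case/negP: nk.
have g8 := dvdz_gcdl 8 n; have gn := dvdz_gcdr 8 n.
(* Subtracting three times the second congruence from the first eliminates [y]. *)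
rewrite (_ : 2 * k = 8 * x + ((x + y *+ 3 - k) - (y + x *+ 3 - k) *+ 3)); last ring.
apply: rpredD; first exact: dvdz_mulr.
by apply: rpredB; rewrite ?rpredMn //; exact: dvdz_trans gn _.
Qed.

Theorem theorem5p3 (k n : int) (hn : (0 < n)%R) :
  [/\ closed_chi R3 n k = (if (gcdz 7 n %| k)%Z then 3 else 4)%N,
      closed_chi R4 n k = (if (gcdz 5 n %| k)%Z then 2 else 3)%N
    & closed_chi R6 n k = (if (gcdz 8 n %| (2 * k)%R)%Z then 2 else 3)%N].
Proof. by have n0 := lt0r_neq0 hn; split; [exact: R3_chi|exact: R4_chi|exact: R6_chi]. Qed.
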